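(* Let $S\subseteq\mathbb{Q}$ be a finite nonempty set and let $r\in\mathbb{Q}\setminus\{-1,0,1\}$. Let $X=S\times S$, regarded as a finite alphabet whose letters are pairs $\begin{bmatrix} s_1\\ s_2\end{bmatrix}$ with $s_1,s_2\in S$; a word $\begin{bmatrix}\sigma_1\\ \tau_1\end{bmatrix}\cdots\begin{bmatrix}\sigma_\ell\\ \tau_\ell\end{bmatrix}\in X^*$ is identified with the pair of equal-length words $\begin{bmatrix} w_1\\ w_2\end{bmatrix}$, $w_1=\sigma_1\cdots\sigma_\ell$, $w_2=\tau_1\cdots\tau_\ell\in S^*$. Then the language \[L=\left\{\begin{bmatrix} w_1\\ w_2\end{bmatrix}\in X^*\colon \mathrm{val}_r(w_1)=\mathrm{val}_r(w_2)\right\}\] is effectively regular, i.e. it is regular and a finite automaton accepting it can be computed from $S$ and $r$.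
   Context: For a nonzero rational number $r$ and a finite word $w=w_{n-1}\cdots w_1w_0$ whose letters (''digits'') $w_i$ are rational numbers (written left to right, $w_0$ being the rightmost letter), $\mathrm{val}_r(w)=\sum_{i=0}^{n-1}w_i r^i$. *)

(* Defs.v *)
From HB Require Import structures.
From mathcomp Require Import all_boot all_order all_algebra.
Set Implicit Arguments. Unset Strict Implicit. Unset Printing Implicit Defensive.
Import Order.TTheory GRing.Theory Num.Theory.
Local Open Scope ring_scope.

(* val_r(w) = sum_{i=0}^{n-1} w_i r^i, where the word w = w_{n-1} ... w_0 is
   stored as the sequence [:: w_{n-1}; ...; w_0] (left to right), so that
   w_i = nth 0 w (size w - 1 - i). *)
Definition valr (r : rat) (w : seq rat) : rat :=
  \sum_(i < size w) nth 0 w (size w - 1 - i)%N * r ^+ i.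

Record dfa (T : finType) := Dfa {
  dfa_size : nat;
  dfa_start : 'I_dfa_size;
  dfa_trans : 'I_dfa_size -> T -> 'I_dfa_size;
  dfa_final : pred 'I_dfa_size
}.

Definition dfa_accept (T : finType) (A : dfa T) (w : seq T) : bool :=
  @dfa_final T A (foldl (@dfa_trans T A) (@dfa_start T A) w).

Definition pair_alph (S : seq rat) : finType := (seq_sub S * seq_sub S)%type.

Definition top_word (S : seq rat) (w : seq (pair_alph S)) : seq rat :=
  map (fun x => ssval x.1) w.
Definition bot_word (S : seq rat) (w : seq (pair_alph S)) : seq rat :=
  map (fun x => ssval x.2) w.

(* Main.v *)
Require Import Defs.
From mathcomp Require Import all_boot all_order all_algebra.
From mathcomp Require Import ring lra zify.
Set Implicit Arguments. Unset Strict Implicit. Unset Printing Implicit Defensive.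
Import Order.TTheory GRing.Theory Num.Theory.
Local Open Scope ring_scope.

(* Reading a pair word letter by letter, d(w) = val_r(w_1) - val_r(w_2)
   evolves by d(wx) = r d(w) + (x_1 - x_2), a Horner step with digits
   bounded by M and with common denominator D.  If some extension wv is
   accepted, d(w) is confined to a finite set.  It is bounded: for |r| < 1
   by the geometric series M / (1 - |r|), and for |r| > 1 because once |d|
   exceeds M / (|r| - 1) it can never return to 0.  And D d(w) is an
   integer: it becomes one after multiplying by den(r)^|w|, and, since
   r^|v| d(w) = - val_r(v), also after multiplying by num(r)^|v|; these
   multipliers are coprime.  So the values of d that can still reach 0 lie
   on a bounded grid of step 1/D, which an automaton tracks with one extra
   sink state for everything else. *)

Section LiveStateAutomaton.

Variables (T : finType) (V : eqType) (f : V -> T -> V) (x0 : V).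
Variables (acc : pred V) (K : seq V).

(* State [i < size K] stands for the value [nth x0 K i]; [size K] is the sink. *)
Definition live_dfa : dfa T :=
  @Dfa T (size K).+1 (inord (index x0 K))
    (fun i x => inord (if (i < size K)%N then index (f (nth x0 K i) x) K
                       else size K))
    (fun i => (i < size K)%N && acc (nth x0 K i)).

Hypothesis live_mem :
  forall w v, acc (foldl f x0 (w ++ v)) -> foldl f x0 w \in K.

Let run w := foldl (@dfa_trans T live_dfa) (@dfa_start T live_dfa) w.

Lemma live_dfa_run w :
  val (run w) = index (foldl f x0 w) K \/
  val (run w) = size K /\ forall v, ~~ acc (foldl f x0 (w ++ v)).
Proof.
elim/last_ind: w => [|w x IH].
  by left; rewrite /run /= inordK // ltnS index_size.
rewrite /run foldl_rcons -/(run w) /= inordK; last first.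
  by rewrite ltnS; case: ifP => // _; exact: index_size.
have dead_rcons v : (forall v', ~~ acc (foldl f x0 (w ++ v'))) ->
    ~~ acc (foldl f x0 (rcons w x ++ v)) by rewrite cat_rcons.
case: IH => [run_w | [run_w dead_w]]; rewrite run_w; last first.
  by right; rewrite ltnn; split=> // v; exact: dead_rcons.
have [w_in | w_notin] := boolP (foldl f x0 w \in K).
  by left; rewrite index_mem w_in nth_index // foldl_rcons.
right; rewrite memNindex // ltnn; split=> // v; apply: dead_rcons => {}v.
by apply/negP => /live_mem; rewrite (negbTE w_notin).
Qed.

Lemma live_dfa_accept w : dfa_accept live_dfa w = acc (foldl f x0 w).
Proof.
rewrite /dfa_accept -/(run w) /=.
case: (live_dfa_run w) => [-> | [-> dead_w]]; last first.
  by rewrite ltnn; apply/esym/negbTE; have := dead_w [::]; rewrite cats0.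
have [w_in | w_notin] := boolP (foldl f x0 w \in K).
  by rewrite index_mem w_in nth_index.
rewrite memNindex // ltnn; apply/esym/negbTE/negP; rewrite -[w]cats0.
by move=> /live_mem; rewrite (negbTE w_notin).
Qed.

End LiveStateAutomaton.

Section RadixValue.

Variable r : rat.

Lemma valr_nil : valr r [::] = 0.
Proof. by rewrite /valr big_ord0. Qed.

Lemma valr_rcons s a : valr r (rcons s a) = r * valr r s + a.
Proof.
rewrite /valr size_rcons big_ord_recl /= expr0 mulr1 nth_rcons.
have -> : ((size s).+1 - 1 - 0 = size s)%N by lia.
rewrite ltnn eqxx addrC mulr_sumr; congr (_ + _); apply: eq_bigr => i _.
have -> : ((size s).+1 - 1 - bump 0 i = size s - 1 - i)%N by rewrite /bump; lia.
rewrite nth_rcons /bump /= exprS mulrCA.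
by have -> : (size s - 1 - i < size s)%N by have := ltn_ord i; lia.
Qed.

Lemma valr_cat s t : valr r (s ++ t) = r ^+ size t * valr r s + valr r t.
Proof.
elim/last_ind: t => [|t a IH].
  by rewrite cats0 valr_nil expr0 mul1r addr0.
by rewrite -rcons_cat !valr_rcons IH size_rcons exprS; ring.
Qed.

Lemma valr_map_foldl (T : Type) (g : T -> rat) s :
  valr r (map g s) = foldl (fun d x => r * d + g x) 0 s.
Proof.
elim/last_ind: s => [|s x IH]; first by rewrite valr_nil.
by rewrite map_rcons valr_rcons IH foldl_rcons.
Qed.

Lemma valr_map_sub (T : Type) (g h : T -> rat) s :
  valr r [seq g x - h x | x <- s] = valr r (map g s) - valr r (map h s).
Proof.
elim/last_ind: s => [|s x IH]; first by rewrite !valr_nil subr0.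
by rewrite !map_rcons !valr_rcons IH; ring.
Qed.

End RadixValue.

Definition escape_radius (r M : rat) : rat := M / `| `|r| - 1 |.

Section BoundedDigits.

Variables (r M : rat).
Hypothesis M_ge0 : 0 <= M.
Let small_digits := all (fun a : rat => `|a| <= M).
Let B := escape_radius r M.

Let B_ge0 : 0 <= B. Proof. exact: divr_ge0. Qed.

Lemma norm_valr_le_escape_radius u :
  `|r| < 1 -> small_digits u -> `|valr r u| <= B.
Proof.
move=> r_lt1; have eB : B * (1 - `|r|) = M.
  rewrite /B /escape_radius ler0_norm ?subr_le0 ?ltW // opprB.
  by rewrite mulfVK ?subr_eq0 ?gt_eqF.
elim/last_ind: u => [|u a IH]; first by rewrite valr_nil normr0.
rewrite /small_digits all_rcons valr_rcons => /andP[a_le /IH u_le].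
have := ler_normD (r * valr r u) a; rewrite normrM.
have : `|r| * `|valr r u| <= `|r| * B by rewrite ler_wpM2l.
nra.
Qed.

Lemma escape_radius_lt_norm_valr_cat u v : 1 < `|r| -> small_digits v ->
  B < `|valr r u| -> B < `|valr r (u ++ v)|.
Proof.
move=> r_gt1; have eB : B * (`|r| - 1) = M.
  by rewrite /B /escape_radius gtr0_norm ?subr_gt0 // mulfVK ?subr_eq0 ?gt_eqF.
move=> + u_gt; elim/last_ind: v => [|v a IH]; first by rewrite cats0.
rewrite /small_digits all_rcons -rcons_cat valr_rcons => /andP[a_le /IH uv_gt].
have := lerB_normD (r * valr r (u ++ v)) a; rewrite normrM.
have : `|r| * B < `|r| * `|valr r (u ++ v)|.
  by rewrite ltr_pM2l // (lt_trans ltr01 r_gt1).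
nra.
Qed.

Lemma norm_valr_prefix_le_escape_radius u v :
  r != 1 -> r != -1 -> small_digits u -> small_digits v ->
  valr r (u ++ v) = 0 -> `|valr r u| <= B.
Proof.
move=> r_neq1 r_neqN1 u_small v_small uv0.
case: (ltrgtP `|r| 1) => [r_lt1 | r_gt1 | r_norm1].
- exact: norm_valr_le_escape_radius.
- rewrite leNgt; apply/negP => /(escape_radius_lt_norm_valr_cat r_gt1 v_small).
  by rewrite uv0 normr0 ltNge B_ge0.
- by move/eqP: r_norm1; rewrite eqr_norml (negbTE r_neq1) (negbTE r_neqN1).
Qed.

End BoundedDigits.

Lemma int_of_coprime_multiples (x : rat) (a b : int) : coprimez a b ->
  a%:~R * x \is a Num.int -> b%:~R * x \is a Num.int -> x \is a Num.int.
Proof.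
move=> /eqP ab_coprime ax_int bx_int; have [u [v uv]] := Bezoutz a b.
have -> : x = u%:~R * (a%:~R * x) + v%:~R * (b%:~R * x).
  by rewrite !mulrA -!intrM -mulrDl -intrD uv ab_coprime mul1r.
by rewrite rpredD // rpredM // intr_int.
Qed.

Section DenominatorDigits.

Variables (r : rat) (D : int).
Let integral_digits := all (fun a : rat => D%:~R * a \is a Num.int).

Lemma valr_den_scaled_int u :
  integral_digits u -> D%:~R * (denq r)%:~R ^+ size u * valr r u \is a Num.int.
Proof.
elim/last_ind: u => [|u a IH]; first by rewrite valr_nil mulr0 rpred0.
rewrite /integral_digits all_rcons => /andP[a_int /IH u_int].
have -> : D%:~R * (denq r)%:~R ^+ (size (rcons u a)) * valr r (rcons u a) =
    (numq r)%:~R * (D%:~R * (denq r)%:~R ^+ size u * valr r u)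
    + (denq r)%:~R ^+ (size u).+1 * (D%:~R * a).
  by rewrite size_rcons valr_rcons numqE exprS; ring.
by rewrite rpredD // rpredM // ?rpredX // intr_int.
Qed.

Lemma prefix_valr_int u v : integral_digits u -> integral_digits v ->
  valr r (u ++ v) = 0 -> D%:~R * valr r u \is a Num.int.
Proof.
move=> u_int v_int uv0.
apply: (@int_of_coprime_multiples _ (denq r ^+ size u) (numq r ^+ size v)).
- by apply/coprimezXl/coprimezXr; rewrite coprimezE coprime_sym coprime_num_den.
- by rewrite rmorphXn /= mulrCA mulrA valr_den_scaled_int.
have shift : r ^+ size v * valr r u = - valr r v.
  by apply/eqP; rewrite -addr_eq0 -valr_cat uv0.
have -> : (numq r ^+ size v)%:~R * (D%:~R * valr r u) =
    - (D%:~R * (denq r)%:~R ^+ size v * valr r v).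
  by rewrite -mulrN -shift rmorphXn /= numqE exprMn; ring.
by rewrite rpredN valr_den_scaled_int.
Qed.

End DenominatorDigits.

Definition grid (D : int) (N : nat) : seq rat :=
  [seq (i%:R - N%:R) / D%:~R | i <- iota 0 (N + N).+1].

Lemma mem_grid (D : int) (b x : rat) : 0 < D ->
  D%:~R * x \is a Num.int -> `|D%:~R * x| <= b -> x \in grid D (Num.truncn b).
Proof.
move=> D_gt0 /intrP[z Dx] Dx_le; set N := Num.truncn b.
have z_le : (`|z| <= N)%N.
  rewrite truncn_ge_nat ?(le_trans _ Dx_le) //.
  by rewrite natr_absz intr_norm -Dx.
apply/mapP; exists (absz (z + N%:Z)); first by rewrite mem_iota; lia.
have -> : x = z%:~R / D%:~R by rewrite -Dx mulrC mulKf // intr_eq0 gt_eqF.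
congr (_ / _); rewrite -[(absz _)%:R]/((Posz (absz (z + N%:Z)))%:~R).
by rewrite gez0_abs ?intrD ?addrK //; lia.
Qed.

Lemma prefix_valr_mem_grid (r M : rat) (D : int) (u v : seq rat) :
  r != 1 -> r != -1 -> 0 <= M -> 0 < D ->
  all (fun a => `|a| <= M) (u ++ v) ->
  all (fun a => D%:~R * a \is a Num.int) (u ++ v) ->
  valr r (u ++ v) = 0 -> valr r u \in grid D (Num.truncn (D%:~R * escape_radius r M)).
Proof.
move=> r_neq1 r_neqN1 M_ge0 D_gt0.
rewrite !all_cat => /andP[u_small v_small] /andP[u_int v_int] uv0.
apply: mem_grid => //; first exact: prefix_valr_int u_int v_int uv0.
rewrite normrM gtr0_norm ?ltr0z // ler_pM2l ?ltr0z //.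
exact: (@norm_valr_prefix_le_escape_radius r M M_ge0 u v).
Qed.

Lemma norm_le_sum_norm (S : seq rat) (s : rat) :
  s \in S -> `|s| <= \sum_(t <- S) `|t|.
Proof. by move=> sS; rewrite (big_rem s sS) /= lerDl sumr_ge0. Qed.

Lemma norm_subr_le_sum_norm (S : seq rat) (s t : rat) :
  s \in S -> t \in S -> `|s - t| <= 2 * \sum_(u <- S) `|u|.
Proof.
move=> /norm_le_sum_norm s_le /norm_le_sum_norm t_le.
by have := ler_normB s t; lra.
Qed.

Lemma prod_denq_mul_int (S : seq rat) s :
  s \in S -> (\prod_(t <- S) denq t)%:~R * s \is a Num.int.
Proof.
move=> sS; rewrite (big_rem s sS) /= intrM mulrAC [_ * s]mulrC -numqE -intrM.
exact: intr_int.
Qed.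

Theorem lemma3p3 (S : seq rat) (r : rat) :
  S != [::] -> r != -1 -> r != 0 -> r != 1 ->
  { A : dfa (pair_alph S) |
    forall w : seq (pair_alph S),
      dfa_accept A w = (valr r (top_word w) == valr r (bot_word w)) }.
Proof.
move=> _ r_neqN1 _ r_neq1.
pose digit (x : pair_alph S) := ssval x.1 - ssval x.2.
pose M := 2 * \sum_(s <- S) `|s|; pose D := \prod_(s <- S) denq s.
pose step d x := r * d + digit x.
have step_valr w : foldl step 0 w = valr r (map digit w).
  by rewrite valr_map_foldl.
have digit_small w : all (fun a => `|a| <= M) (map digit w).
  by rewrite all_map; apply/allP => x _; rewrite /= norm_subr_le_sum_norm ?ssvalP.
have digit_int w : all (fun a => D%:~R * a \is a Num.int) (map digit w).
  rewrite all_map; apply/allP => x _.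
  by rewrite /= mulrBr rpredB ?prod_denq_mul_int ?ssvalP.
pose K := grid D (Num.truncn (D%:~R * escape_radius r M)).
have live w v : foldl step 0 (w ++ v) == 0 -> foldl step 0 w \in K.
  rewrite !step_valr map_cat => /eqP.
  apply: prefix_valr_mem_grid; rewrite -?map_cat //.
    by rewrite /M mulr_ge0 ?sumr_ge0.
  by apply: prodr_gt0 => s _; exact: denq_gt0.
exists (live_dfa step 0 (eq_op^~ 0) K) => w.
by rewrite live_dfa_accept // step_valr -[RHS]subr_eq0 -valr_map_sub.
Qed.
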